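(* Let $n$ and $d$ be positive integers with $d\ge 2n-1$. Let $(t_{0\bmod n},\dots,t_{n-1\bmod n})\in\mathbb{C}^n$ be arbitrary. Then, for every polynomial $f=\sum_\nu a_\nu X^\nu\in\mathbb{C}[X]$ of degree $<d$ with $\|f\|_\infty\le 1$, one has $$\left|\sum_{\nu=0}^{d-1}t_{\nu\bmod n}\,a_\nu\right|\le\frac1n\sum_{\omega^n=1}\left|\sum_{\nu=0}^{n-1}\frac{t_{\nu\bmod n}}{\omega^\nu}\right|.$$ Moreover, there is a polynomial $f\in\mathbb{C}[X]$ of degree $<d$ with $\|f\|_\infty\le 1$ for which equality is attained in this inequality; in fact, this $f$ may even be chosen to have degree $\le 2n-2$.
   Context: For a function $f$ on the open complex unit disk $\mathbb{D}$, $\|f\|_\infty=\sup\{|f(z)|: z\in\mathbb{D}\}$. The numbers $t_{\nu\bmod n}$ are indexed by residue classes modulo $n$, so $t_{\nu\bmod n}$ depends only on $\nu$ modulo $n$. The sum $\sum_{\omega^n=1}$ ranges over all complex numbers $\omega$ with $\omega^n=1$. *)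

(* Defs.v *)
From HB Require Import structures.
From mathcomp Require Import all_boot all_order all_algebra.
From mathcomp Require Import all_classical all_reals all_analysis.
From mathcomp Require Import complex.

Set Implicit Arguments.
Unset Strict Implicit.
Unset Printing Implicit Defensive.

Import Order.TTheory GRing.Theory Num.Theory.
Local Open Scope classical_set_scope.
Local Open Scope ring_scope.
Local Open Scope complex_scope.

Definition open_unit_disk (R : realType) : set R[i] :=
  [set z | `|z| < 1].

(* The norm on R[i] takes values in R[i], so its real part is taken to land in
   R. The supremum lives in \bar R: an unbounded g has norm +oo. *)
Definition sup_norm (R : realType) (g : R[i] -> R[i]) : \bar R :=
  ereal_sup [set ((complex.Re `|g z|)%:E) | z in @open_unit_disk R].

Definition residue (n : nat) (n_gt0 : (0 < n)%N) (k : nat) : 'I_n :=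
  Ordinal (ltn_pmod k n_gt0).

(* Main.v *)
Require Import Defs.
From HB Require Import structures.
From mathcomp Require Import all_boot all_order all_algebra.
From mathcomp Require Import all_classical all_reals all_analysis.
From mathcomp Require Import complex.
From mathcomp Require Import cyclic separable cyclotomic.

Set Implicit Arguments.
Unset Strict Implicit.
Unset Printing Implicit Defensive.

Import Order.TTheory GRing.Theory Num.Theory.
Local Open Scope classical_set_scope.
Local Open Scope ring_scope.
Local Open Scope complex_scope.

(** Let T be the discrete Fourier transform of t, so that the right-hand side of
    the inequality is the average of |T(w)| over the n-th roots of unity w.
    Since the weights depend on the index only modulo n, Fourier inversion
    turns the functional into an average of point evaluations
    ([sum_periodic_coef]): the sum of t_k a_k is the average of T(w) f(w).
    A polynomial bounded by 1 on the open disk is bounded by 1 on the circle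
    ([poly_norm_circle_le1]), and the inequality is the triangle inequality.

    Equality holds as soon as f takes at each w the value c_w = |T(w)| / T(w),
    so the point is to interpolate values of modulus at most 1 at the n-th
    roots of unity by a polynomial of degree at most 2n - 2 that stays bounded
    by 1 on the disk. Fejér interpolation does this. The square of
    (1/n) (1 + x/w + ... + (x/w)^(n-1)) is 1 at w and 0 at the other roots of
    unity, and by Parseval ([sum_norm_fejer]) the moduli of these n squares add
    up to the average of |x|^(2k), k < n, which is at most 1 when |x| <= 1.
    Hence their linear combination with coefficients c_w is bounded by 1
    throughout the closed disk, without recourse to the maximum principle. *)

(** * Roots of unity and discrete Fourier inversion *)

(** In characteristic 0 the polynomial X^n - 1 is separable, so a closed field
    contains n distinct roots of it; a group of n such roots is cyclic. *)
Lemma prim_root_exists (C : numClosedFieldType) (n : nat) :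
  (0 < n)%N -> exists z : C, n.-primitive_root z.
Proof.
move=> n_gt0; have [rs] := closed_field_poly_normal ('X^n - 1 : {poly C}).
rewrite (monicP (monicXnsubC _ n_gt0)) scale1r => Xn1E.
have size_rs : size rs = n.
  by apply: succn_inj; rewrite -(size_prod_XsubC rs id) -Xn1E size_Xn_sub_1.
suff /hasP[z _ z_prim] : has n.-primitive_root rs by exists z.
apply: has_prim_root => //; last by rewrite size_rs.
- by apply/allP => w; rewrite -root_prod_XsubC -Xn1E.
- by rewrite -separable_prod_XsubC -Xn1E separable_Xn_sub_1 // pnatr_eq0 -lt0n.
Qed.

Lemma norm_unity_root (C : numDomainType) (n : nat) (w : C) :
  (0 < n)%N -> w ^+ n = 1 -> `|w| = 1.
Proof.
move=> n_gt0 wn1; apply/eqP.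
by rewrite -(pexpr_eq1 n_gt0) // -normrX wn1 normr1.
Qed.

Lemma sum_expr_unity_root (F : fieldType) (n : nat) (x : F) :
  x ^+ n = 1 -> \sum_(j < n) x ^+ j = n%:R * (x == 1)%:R.
Proof.
move=> xn1; have [->|x_neq1] := eqVneq x 1.
  under eq_bigr do rewrite expr1n.
  by rewrite sumr_const card_ord mulr1.
rewrite mulr0; apply/eqP.
have /eqP := subrX1 x n; rewrite xn1 subrr eq_sym mulf_eq0 subr_eq0.
by rewrite (negPf x_neq1).
Qed.

(** The summand is the j-th power of z^k / z^l, an n-th root of unity that is 1
    exactly when k and l agree modulo n; otherwise the geometric sum vanishes.
    Fourier inversion, the interpolation property of the Fejér polynomials and
    Parseval's identity for them are all instances of this relation. *)
Lemma prim_root_orthogonality (F : fieldType) (n : nat) (z : F) (k l : nat) :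
  n.-primitive_root z ->
  \sum_(j < n) (z ^+ j) ^+ k / (z ^+ j) ^+ l
    = n%:R * (k == l %[mod n])%:R.
Proof.
move=> z_prim; have zn1 := prim_expr_order z_prim.
have z_unit : z \is a GRing.unit.
  by rewrite unitfE (prim_root_eq0 z_prim) -lt0n (prim_order_gt0 z_prim).
rewrite -(eq_prim_root_expr z_prim).
under eq_bigr do rewrite exprAC [in X in _ / X]exprAC -expr_div_n.
rewrite sum_expr_unity_root; last first.
  by rewrite expr_div_n !(exprAC _ _ n) zn1 !expr1n divr1.
by rewrite -[1](@divrr _ (z ^+ l)) ?unitrX // (inj_eq (divIr _)) // unitrX.
Qed.

(** Listing the n-th roots of unity as powers of one primitive root replaces
    sums over a classical set by sums over ordinals, to which exchange of
    summation and orthogonality apply directly. *)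
Lemma fsbig_unity_roots (F : fieldType) (V : nmodType) (n : nat) (z : F)
    (G : F -> V) :
  n.-primitive_root z ->
  \sum_(w \in [set w : F | w ^+ n = 1]) G w = \sum_(j < n) G (z ^+ j).
Proof.
move=> z_prim; pose rs := [seq z ^+ j | j : 'I_n].
have rs_uniq : uniq rs.
  rewrite map_inj_uniq ?enum_uniq // => i j /eqP.
  rewrite (eq_prim_root_expr z_prim) !modn_small // => /eqP; exact: val_inj.
transitivity (\sum_(w <- rs) G w); last by rewrite big_image.
rewrite [RHS]fsbig_seq //; apply: eq_fsbigl; apply/seteqP; split=> w /=.
  by move=> /(prim_rootP z_prim)[j ->]; apply/mapP; exists j; rewrite ?mem_enum.
by move=> /mapP[j _ ->]; rewrite exprAC (prim_expr_order z_prim) expr1n.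
Qed.

Definition dft (F : fieldType) (n : nat) (s : nat -> F) (w : F) : F :=
  \sum_(0 <= k < n) s k / w ^+ k.

Lemma dft_inversion (F : fieldType) (n : nat) (z : F) (s : nat -> F) :
  n%:R != 0 :> F -> n.-primitive_root z -> (forall k, s (k %% n)%N = s k) ->
  forall k, s k = n%:R^-1 * \sum_(j < n) dft n s (z ^+ j) * (z ^+ j) ^+ k.
Proof.
move=> n_neq0 z_prim s_per k; have n_gt0 := prim_order_gt0 z_prim.
under eq_bigr do rewrite /dft big_mkord big_distrl.
rewrite exchange_big /=.
under eq_bigr => l _.
  under eq_bigr do rewrite mulrAC -mulrA.
  rewrite -big_distrr /= prim_root_orthogonality // mulrCA.
  over.
rewrite -big_distrr /= mulKf // (bigD1 (Ordinal (ltn_pmod k n_gt0))) //=.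
rewrite modn_mod eqxx mulr1 s_per big1 ?addr0 // => l.
rewrite -val_eqE /= => l_neq.
by rewrite [(l %% n)%N]modn_small // eq_sym (negPf l_neq) mulr0.
Qed.

(** Inversion holds at every index k because s is n-periodic, even when k is
    beyond n. Substituting it and exchanging the sums collects the powers of
    each root of unity into the value of f there. *)
Lemma sum_periodic_coef (F : fieldType) (n d : nat) (z : F) (s : nat -> F)
    (f : {poly F}) :
  n%:R != 0 :> F -> n.-primitive_root z -> (forall k, s (k %% n)%N = s k) ->
  (size f <= d)%N ->
  \sum_(0 <= k < d) s k * f`_k
    = n%:R^-1 * \sum_(j < n) dft n s (z ^+ j) * f.[z ^+ j].
Proof.
move=> n_neq0 z_prim s_per size_f.
under eq_bigr do rewrite (dft_inversion n_neq0 z_prim s_per) -mulrA big_distrl.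
rewrite -big_distrr exchange_big /=; congr (_ * _); apply: eq_bigr => j _.
rewrite (horner_coef_wide _ size_f) big_distrr /= big_mkord.
by apply: eq_bigr => k _; rewrite -mulrA [_ * f`_k]mulrC.
Qed.

(** * Boundary values of polynomials bounded on the open disk *)

(** By the factor theorem f - f(x) = q (X - x), and on the closed disk q is
    bounded by the sum of the moduli of its coefficients. *)
Lemma poly_lipschitz (C : numFieldType) (f : {poly C}) (x : C) :
  exists2 L, 0 <= L
    & forall y, `|y| <= 1 -> `|f.[x] - f.[y]| <= L * `|x - y|.
Proof.
have /factor_theorem[q fE] : root (f - f.[x]%:P) x.
  by rewrite rootE !hornerE subrr.
exists (\sum_(i < size q) `|q`_i|) => [|y y_le1]; first exact: sumr_ge0.
have -> : f.[x] - f.[y] = q.[y] * (x - y).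
  have := congr1 (fun p : {poly C} => p.[y]) fE; rewrite !hornerE => fyE.
  by rewrite -[LHS]opprB fyE -mulrN opprB.
rewrite normrM ler_wpM2r // horner_coef (le_trans (ler_norm_sum _ _ _)) //.
apply: ler_sum => i _; rewrite normrM normrX.
by rewrite ler_piMr // exprn_ile1.
Qed.

(** The Lipschitz bound at x passes to the limit along the radius: f(x) is
    within L h of f((1 - h) x), for h > 0 as small as desired. *)
Lemma poly_norm_circle_le1 (C : numFieldType) (f : {poly C}) :
  (forall y, `|y| < 1 -> `|f.[y]| <= 1) ->
  forall x, `|x| = 1 -> `|f.[x]| <= 1.
Proof.
move=> f_le1 x x1; have [L L_ge0 lipL] := poly_lipschitz f x.
apply/ler_addgt0Pl => e e_gt0.
have Le_gt0 : 0 < L + e by rewrite ltr_wpDl.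
(* Adding e to L keeps h in ]0, 1] when L is small, and still gives L h <= e. *)
pose h := e / (L + e).
have h_gt0 : 0 < h by rewrite divr_gt0.
have h_le1 : h <= 1 by rewrite ler_pdivrMr // mul1r lerDr.
pose y := (1 - h) * x.
have y_lt1 : `|y| < 1.
  by rewrite normrM x1 mulr1 ger0_norm ?subr_ge0 // gtrBl.
have xyE : `|x - y| = h.
  by rewrite /y mulrBl mul1r opprB addrC subrK normrM x1 mulr1 gtr0_norm.
rewrite -[f.[x]](subrK f.[y]) (le_trans (ler_normD _ _)) // lerD ?f_le1 //.
rewrite (le_trans (lipL y (ltW y_lt1))) // xyE mulrCA ler_piMr // ?(ltW e_gt0) //.
by rewrite ler_pdivrMr // mul1r lerDl ltW.
Qed.

(** * Fejér interpolation at the roots of unity *)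

(** On the unit circle this equals (x/w)^(n-1) times the Fejér kernel at x/w,
    normalised to be 1 at x = w: the extra power makes it a polynomial and does
    not change its modulus. *)
Definition fejer (F : fieldType) (n : nat) (w : F) : {poly F} :=
  (n%:R^-1 *: \poly_(k < n) w ^- k) ^+ 2.

Lemma horner_fejer (F : fieldType) (n : nat) (w x : F) :
  (fejer n w).[x] = (n%:R^-1 * \sum_(k < n) x ^+ k / w ^+ k) ^+ 2.
Proof.
rewrite horner_exp hornerZ horner_poly.
by under eq_bigr do rewrite mulrC.
Qed.

Lemma size_fejer (F : fieldType) (n : nat) (w : F) :
  (0 < n)%N -> (size (fejer n w) <= (2 * n - 2).+1)%N.
Proof.
move=> n_gt0; apply: leq_trans (size_poly_exp_leq _ _) _.
rewrite ltnS mulnC -[X in (_ <= _ - X)%N](muln1 2) -mulnBr leq_mul2l /= subn1.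
by rewrite -!subn1 leq_sub2r // (leq_trans (size_scale_leq _ _)) // size_poly.
Qed.

Lemma fejer_unity_root (F : fieldType) (n : nat) (z : F) (i j : 'I_n) :
  n%:R != 0 :> F -> n.-primitive_root z ->
  (fejer n (z ^+ i)).[z ^+ j] = (i == j)%:R.
Proof.
move=> n_neq0 z_prim; rewrite horner_fejer.
under eq_bigr do rewrite exprAC [in X in _ / X]exprAC.
rewrite prim_root_orthogonality // mulKf // eq_sym !modn_small //.
by rewrite -val_eqE; case: eqP; rewrite (expr1n, expr0n).
Qed.

(** Parseval's identity: the modulus of the square of a sum is the square of its
    modulus, which expands into a double sum over k and l. Summing over the
    roots of unity leaves only the diagonal k = l, with terms |x|^(2k). *)
Lemma sum_norm_fejer (C : numClosedFieldType) (n : nat) (z x : C) :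
  n.-primitive_root z ->
  \sum_(j < n) `|(fejer n (z ^+ j)).[x]|
    = n%:R^-1 * \sum_(k < n) `|x| ^+ (2 * k).
Proof.
move=> z_prim; have n_gt0 := prim_order_gt0 z_prim.
have n_neq0 : n%:R != 0 :> C by rewrite pnatr_eq0 -lt0n.
have normE (j : 'I_n) : `|(fejer n (z ^+ j)).[x]| = n%:R^-1 ^+ 2 *
    \sum_(k < n) \sum_(l < n) x ^+ k * x^* ^+ l
      * ((z ^+ j) ^+ l / (z ^+ j) ^+ k).
  have : `|z ^+ j| = 1.
    apply: (norm_unity_root n_gt0).
    by rewrite exprAC (prim_expr_order z_prim) expr1n.
  rewrite horner_fejer; move: (z ^+ j) => u u1.
  have u_neq0 : u != 0 by rewrite -normr_eq0 u1 oner_eq0.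
  (* On the unit circle conjugation is inversion, which makes the cross terms
     quotients of powers of u. *)
  have conj_u : (u^*)%R = u^-1 by rewrite invC_norm u1 expr1n invr1 mul1r.
  rewrite normrX normrM normfV normr_nat exprMn; congr (_ * _).
  rewrite normCK rmorph_sum big_distrl; apply: eq_bigr => k _ /=.
  rewrite big_distrr; apply: eq_bigr => l _ /=.
  rewrite rmorphM rmorphV ?unitrX ?unitfE //= !rmorphXn /= conj_u.
  by rewrite exprVn invrK mulrACA [_^-1 * _]mulrC.
under eq_bigr do rewrite normE.
rewrite -big_distrr exchange_big /= expr2 -mulrA; congr (_ * _).
rewrite big_distrr; apply: eq_bigr => k _ /=; rewrite exchange_big /=.
under eq_bigr do rewrite -big_distrr /= prim_root_orthogonality //.
rewrite (bigD1 k) //= eqxx mulr1 big1 ?addr0 => [|l l_neq].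
  by rewrite mulrC mulfK // -exprMn -normCK -exprM.
by rewrite !modn_small // val_eqE (negPf l_neq) !mulr0.
Qed.

Definition fejer_interpolant (F : fieldType) (n : nat) (z : F) (c : 'I_n -> F)
    : {poly F} :=
  \sum_(j < n) c j *: fejer n (z ^+ j).

Lemma size_fejer_interpolant (F : fieldType) (n : nat) (z : F) (c : 'I_n -> F) :
  (0 < n)%N -> (size (fejer_interpolant z c) <= (2 * n - 2).+1)%N.
Proof.
move=> n_gt0; apply: leq_trans (size_sum _ _ _) _.
apply/bigmax_leqP => j _.
exact: leq_trans (size_scale_leq _ _) (size_fejer _ n_gt0).
Qed.

Lemma fejer_interpolant_unity_root (F : fieldType) (n : nat) (z : F)
    (c : 'I_n -> F) (j : 'I_n) :
  n%:R != 0 :> F -> n.-primitive_root z ->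
  (fejer_interpolant z c).[z ^+ j] = c j.
Proof.
move=> n_neq0 z_prim; rewrite horner_sum.
under eq_bigr do rewrite hornerZ fejer_unity_root //.
rewrite (bigD1 j) //= eqxx mulr1 big1 ?addr0 // => i /negPf ->.
by rewrite mulr0.
Qed.

Lemma fejer_interpolant_norm_le1 (C : numClosedFieldType) (n : nat) (z : C)
    (c : 'I_n -> C) :
  n.-primitive_root z -> (forall j, `|c j| <= 1) ->
  forall x, `|x| <= 1 -> `|(fejer_interpolant z c).[x]| <= 1.
Proof.
move=> z_prim c_le1 x x_le1; have n_gt0 := prim_order_gt0 z_prim.
rewrite horner_sum (le_trans (ler_norm_sum _ _ _)) //.
apply: (@le_trans _ _ (\sum_(j < n) `|(fejer n (z ^+ j)).[x]|)).
  by apply: ler_sum => j _; rewrite hornerZ normrM ler_piMl.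
rewrite sum_norm_fejer // ler_pdivrMl ?ltr0n // mulr1.
apply: (@le_trans _ _ (\sum_(k < n) 1)); last by rewrite sumr_const card_ord.
by apply: ler_sum => k _; rewrite exprn_ile1.
Qed.

(** * The extremal problem *)

(** Modulus is valued in R[i] but the supremum norm in the extended reals; the
    two bounds agree because a modulus has zero imaginary part. *)
Lemma sup_norm_le1P (R : realType) (g : R[i] -> R[i]) :
  (sup_norm g <= 1)%E <-> (forall x, `|x| < 1 -> `|g x| <= 1).
Proof.
have normE (x : R[i]) : (`|x| <= 1) = (complex.Re `|x| <= 1).
  by rewrite lecE normc_def /= eqxx.
split=> [g_le1 x x_lt1|g_le1].
  rewrite normE -lee_fin; apply: le_trans g_le1.
  by apply: ereal_sup_ubound; exists x.
apply: ge_ereal_sup => _ [x x_lt1 <-].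
by rewrite lee_fin -normE g_le1.
Qed.

Theorem theorem2p6 (R : realType) (n d : nat) (n_gt0 : (0 < n)%N)
    (d_gt0 : (0 < d)%N) (le_d : (2 * n - 1 <= d)%N) (t : 'I_n -> R[i]) :
  (forall f : {poly R[i]},
      (size f <= d)%N ->
      (sup_norm (fun z => f.[z]) <= 1)%E ->
      `|\sum_(0 <= nu < d) t (residue n_gt0 nu) * f`_nu|
        <= n%:R^-1 * \sum_(w \in [set w : R[i] | w ^+ n = 1])
             `|\sum_(0 <= nu < n) t (residue n_gt0 nu) / w ^+ nu|)
  /\
  (exists f : {poly R[i]},
      [/\ (size f <= d)%N,
          (size f <= (2 * n - 2).+1)%N,
          (sup_norm (fun z => f.[z]) <= 1)%E
        & `|\sum_(0 <= nu < d) t (residue n_gt0 nu) * f`_nu|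
          = n%:R^-1 * \sum_(w \in [set w : R[i] | w ^+ n = 1])
               `|\sum_(0 <= nu < n) t (residue n_gt0 nu) / w ^+ nu|]).
Proof.
have [z z_prim] := prim_root_exists R[i] n_gt0.
have n_neq0 : n%:R != 0 :> R[i] by rewrite pnatr_eq0 -lt0n.
pose s k := t (residue n_gt0 k).
have s_per k : s (k %% n)%N = s k.
  by congr t; apply: val_inj; rewrite /= modn_mod.
have pairing f := sum_periodic_coef n_neq0 z_prim s_per (f := f) (d := d).
rewrite (fsbig_unity_roots (fun w => `|dft n s w|) z_prim); split.
  move=> f size_f /sup_norm_le1P f_le1.
  rewrite pairing // normrM normfV normr_nat ler_wpM2l ?invr_ge0 //.
  rewrite (le_trans (ler_norm_sum _ _ _)) //; apply: ler_sum => j _.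
  rewrite normrM ler_piMr // poly_norm_circle_le1 //.
  apply: (norm_unity_root n_gt0).
  by rewrite exprAC (prim_expr_order z_prim) expr1n.
(* Where the transform vanishes, this value is 0 since 0^-1 = 0; any value of
   modulus at most 1 would do there. *)
pose c (j : 'I_n) := `|dft n s (z ^+ j)| / dft n s (z ^+ j).
have c_le1 j : `|c j| <= 1.
  rewrite normrM normfV normr_id.
  have [->|?] := eqVneq (dft n s (z ^+ j)) 0; first by rewrite normr0 mul0r.
  by rewrite divff // normr_eq0.
have size_f := size_fejer_interpolant z c n_gt0.
have size_f_d : (size (fejer_interpolant z c) <= d)%N.
  apply: leq_trans size_f _; apply: leq_trans le_d.
  by rewrite -subSn ?leq_pmulr // subSS.
exists (fejer_interpolant z c); split=> //.
  apply/sup_norm_le1P => x /ltW; exact: fejer_interpolant_norm_le1.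
rewrite pairing //.
under eq_bigr do rewrite fejer_interpolant_unity_root //.
have -> : \sum_(j < n) dft n s (z ^+ j) * c j
    = \sum_(j < n) `|dft n s (z ^+ j)|.
  apply: eq_bigr => j _; rewrite /c mulrCA.
  have [->|?] := eqVneq (dft n s (z ^+ j)) 0; first by rewrite normr0 mul0r.
  by rewrite divff ?mulr1.
by rewrite ger0_norm // mulr_ge0 ?invr_ge0 // sumr_ge0.
Qed.
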